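(* For every integer $g \ge 0$ let $n_g$ denote the number of numerical semigroups of genus $g$, and let $(F_i)_{i\ge 0}$ be the Fibonacci sequence with $F_0=0$, $F_1=1$, $F_{i}=F_{i-1}+F_{i-2}$. Then $2F_g \le n_g$ for all $g \ge 2$, and $2F_g \le n_g \le 1 + 3\cdot 2^{g-3}$ for all $g \ge 3$.
   Context: A numerical semigroup is a subset $\Lambda \subseteq \mathbb{N}_0=\{0,1,2,\dots\}$ containing $0$, closed under addition, and with finite complement $\mathbb{N}_0\setminus\Lambda$. The elements of $\mathbb{N}_0\setminus\Lambda$ are the gaps of $\Lambda$, and the genus of $\Lambda$ is the number of gaps $|\mathbb{N}_0\setminus\Lambda|$. *)

(* Defs.v *)
From mathcomp Require Import all_boot finmap all_classical.
Set Implicit Arguments.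
Unset Strict Implicit.
Unset Printing Implicit Defensive.

Local Open Scope classical_set_scope.

Definition gaps (L : set nat) : set nat := ~` L.

Record numerical_semigroup (L : set nat) : Prop := NumericalSemigroup {
  numsg0 : L 0;
  numsgD : forall a b : nat, L a -> L b -> L (a + b);
  numsg_finite_gaps : finite_set (gaps L) }.

(* [fset_set A] is the finite set with the elements of A when A is finite, and
   is empty otherwise. *)
Definition genus (L : set nat) : nat := #|` fset_set (gaps L)|.

Definition semigroups_of_genus (g : nat) : set (set nat) :=
  [set L | numerical_semigroup L /\ genus L = g].

(* The default value 0 for an infinite family cannot satisfy a positive lower
   bound, so any such bound on [num_semigroups g] includes finiteness of the family. *)
Definition num_semigroups (g : nat) : nat := #|` fset_set (semigroups_of_genus g)|.

Fixpoint fib (i : nat) : nat :=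
  match i with
  | 0 => 0
  | 1 => 1
  | (j.+1 as k).+1 => fib k + fib j
  end.

(* Main.v *)
Require Import Defs.
From mathcomp Require Import all_boot finmap all_classical.
From mathcomp Require Import zify.
Set Implicit Arguments.
Unset Strict Implicit.
Unset Printing Implicit Defensive.

(* Adjoining the largest gap to a numerical semigroup of genus [g + 1] gives its
   parent, of genus [g]; conversely the children of a semigroup are obtained by
   removing one of its effective generators, so [n_g] is the size of level [g] of
   this tree.  If a non-ordinary semigroup has [k] effective generators, then
   removing the [i]-th one leaves [k - i] or [k - i + 1] effective generators.
   Hence it has between ['C(k, d)] and ['C(k + d - 1, d)] descendants at depth [d].
   The ordinary semigroup of genus [n > 0] has one ordinary child and [n]
   non-ordinary ones, with [n, n - 2, n - 3, ..., 0] effective generators.  Summing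
   the bounds along the ordinary branch gives the Fibonacci numbers as antidiagonal
   sums of binomial coefficients, and the powers of 2 as row sums. *)

(** * Binomial sums and Fibonacci numbers *)

Lemma sum_bin_col d k : \sum_(j < k) 'C(j, d) = 'C(k, d.+1).
Proof. by elim: k => [|k IHk]; rewrite ?big_ord0 // big_ord_recr IHk binS. Qed.

(** The hypothesis makes ['C(d, c.+1)], the value at [k = 0], vanish. Both [c = d] and [c = d.+1]
    occur below. *)
Lemma sum_bin_col_shift d c k : d <= c ->
  \sum_(j < k) 'C(j + d, c) = 'C(k + d, c.+1).
Proof.
move=> le_dc; elim: k => [|k IHk]; first by rewrite big_ord0 bin_small.
by rewrite big_ord_recr IHk addSn binS.
Qed.

Lemma sum_bin_row n k : n < k -> \sum_(i < k) 'C(n, i) = 2 ^ n.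
Proof.
elim: k => // k IHk; rewrite ltnS leq_eqVlt => /orP[/eqP->|lt_nk].
  rewrite -[2]/(1 + 1) expnDn; apply: eq_bigr => i _.
  by rewrite !exp1n !muln1.
by rewrite big_ord_recr /= IHk // bin_small // addn0.
Qed.

Lemma sum_bin_antidiag_recl k :
  \sum_(i < k.+2) 'C(k.+1 - i, i) = 1 + \sum_(i < k.+1) 'C(k - i, i.+1).
Proof. by rewrite big_ord_recl bin0; congr addn; apply: eq_bigr. Qed.

Lemma fib_sum_bin k : fib k.+1 = \sum_(i < k.+1) 'C(k - i, i).
Proof.
suff [] : fib k.+1 = \sum_(i < k.+1) 'C(k - i, i) /\
  fib k.+2 = \sum_(i < k.+2) 'C(k.+1 - i, i) by [].
elim: k => [|k [IH0 IH1]]; first by rewrite !big_ord_recl !big_ord0.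
split=> //; rewrite -[fib _]/(fib k.+2 + fib k.+1) IH0 IH1.
rewrite !sum_bin_antidiag_recl -addnA -big_split /=; congr addn.
(* The last term ['C(0, k.+2)] vanishes; Pascal's rule matches the others. *)
rewrite [RHS]big_ord_recr /= subnn addn0; apply: eq_bigr => i _.
have le_ik : i <= k by rewrite -ltnS.
by rewrite subSn // binS.
Qed.

(** * Gap lists and effective generators *)

(* The Frobenius number, with value 0 instead of -1 when there is no gap. *)
Definition frob (s : seq nat) : nat := \max_(i <- s) i.

(* A numerical semigroup is encoded by the list [s] of its gaps in decreasing
   order, so that [behead s] encodes its parent.  The effective generators are
   the minimal generators larger than the Frobenius number. *)
Definition is_effgen (s : seq nat) (x : nat) : bool :=
  (frob s < x) && all (fun a => (a \in s) || (x - a \in s)) (iota 1 x.-1).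

(* Every effective generator is at most [(frob s).*2.+1]: a larger number is the
   sum of [(frob s).+1] and of another element that exceeds [frob s]. *)
Definition effgens (s : seq nat) : seq nat :=
  [seq x <- iota 0 (frob s).*2.+2 | is_effgen s x].

Fixpoint descendants (d : nat) (s : seq nat) : seq (seq nat) :=
  if d is d'.+1 then [seq t | x <- effgens s, t <- descendants d' (x :: s)]
  else [:: s].

Lemma frob_cons x s : frob (x :: s) = maxn x (frob s).
Proof. exact: big_cons. Qed.

Lemma leq_frob s x : x \in s -> x <= frob s.
Proof. by move=> xs; apply: (leq_bigmax_seq x). Qed.

Lemma frob_ltP s x : reflect (x > 0 /\ {in s, forall y, y < x}) (frob s < x).
Proof.
case: x => [|x]; first by constructor => -[].
apply: (iffP idP) => [lt_sx|[_ lt_sx]]; last first.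
  by rewrite ltnS; apply/bigmax_leqP_seq => y /lt_sx.
by split=> // y /leq_frob; lia.
Qed.

Lemma mem_effgens s x : x \in effgens s <->
  frob s < x /\ (forall a b, 0 < a -> 0 < b -> a + b = x -> a \in s \/ b \in s).
Proof.
rewrite mem_filter mem_iota /is_effgen; split.
  move=> /andP[/andP[lt_sx /allP gen_x] _]; split=> // a b a0 b0 abx.
  have := gen_x a; rewrite mem_iota -abx addKn => gen_a.
  by apply/orP/gen_a; lia.
move=> [lt_sx gen_x]; rewrite lt_sx add0n ltnS /=; apply/andP; split.
- apply/allP => a; rewrite mem_iota => ax; apply/orP/gen_x; lia.
- rewrite leqNgt; apply/negP => lt_x.
  by case: (gen_x (frob s).+1 (x - (frob s).+1)) => [||| /leq_frob | /leq_frob]; lia.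
Qed.

Lemma frob_child s x : x \in effgens s -> frob (x :: s) = x.
Proof. by move=> /mem_effgens[lt_sx _]; rewrite frob_cons; apply/maxn_idPl/ltnW. Qed.

Lemma effgens_sorted s : sorted ltn (effgens s).
Proof. exact/(sorted_filter ltn_trans)/iota_ltn_sorted. Qed.

Lemma effgens_uniq s : uniq (effgens s).
Proof. exact/filter_uniq/iota_uniq. Qed.

Lemma size_descendantsS d s : size (descendants d.+1 s) =
  \sum_(x <- effgens s) size (descendants d (x :: s)).
Proof. by rewrite /= size_allpairs_dep sumnE big_map. Qed.

(** * Descendants of non-ordinary semigroups *)

(** The number of larger entries takes each value below [size e] once, which turns a sum over
    children into a sum over ranks. *)
Lemma sum_sorted_count (e : seq nat) (h : nat -> nat) : sorted ltn e ->
  \sum_(x <- e) h (count (ltn x) e) = \sum_(j < size e) h j.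
Proof.
elim: e => [|x e IHe] ltn_e; first by rewrite big_nil big_ord0.
have e_gt y : y \in e -> x < y.
  by move: y; apply/allP; apply: order_path_min ltn_e; apply: ltn_trans.
rewrite big_cons big_ord_recr addnC; congr addn.
  rewrite -IHe ?(path_sorted ltn_e) //; apply: eq_big_seq => y /e_gt xy /=.
  by rewrite ltnNge ltnW.
rewrite /= ltnn add0n; congr h; apply/eqP; rewrite -all_count.
exact/allP.
Qed.

(* [m] is the multiplicity, and [m < frob s] says that the semigroup is not
   ordinary, i.e. not of the form {0} u [m, +oo). *)
Definition nonordinary (m : nat) (s : seq nat) : Prop :=
  [/\ 0 < m < frob s, m \notin s & forall a, 0 < a < m -> a \in s].

Lemma nonordinary_child m s x :
  nonordinary m s -> x \in effgens s -> nonordinary m (x :: s).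
Proof.
move=> [/andP[m0 lt_ms] m_s lt_m] x_gen; have /mem_effgens[lt_sx _] := x_gen.
split=> [||a /lt_m a_s]; first by rewrite frob_child // m0 (ltn_trans lt_ms).
- by rewrite inE negb_or m_s andbT; lia.
- by rewrite inE a_s orbT.
Qed.

(* Once [x] is removed, a number [y > x] that was decomposable becomes
   indecomposable only if [y = x + b]; for [b > m] there is the decomposition
   [y = m + (x + b - m)], so that [y = x + m]. *)
Lemma size_effgens_child m s x : nonordinary m s -> x \in effgens s ->
  count (ltn x) (effgens s) <= size (effgens (x :: s))
    <= (count (ltn x) (effgens s)).+1.
Proof.
move=> s_m x_gen; have [/andP[m0 lt_mx] m_xs lt_m] := nonordinary_child s_m x_gen.
rewrite frob_child // in lt_mx.
have /mem_effgens[lt_sx _] := x_gen.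
rewrite -size_filter -[_.+1]/(size (x + m :: _)); apply/andP; split.
  apply: uniq_leq_size => [|y]; first exact/filter_uniq/effgens_uniq.
  rewrite mem_filter => /andP[/= lt_xy /mem_effgens[_ y_gen]].
  apply/mem_effgens; rewrite frob_child //; split=> // a b a0 b0 aby.
  by case: (y_gen a b a0 b0 aby) => ab_s; [left | right]; rewrite inE ab_s orbT.
apply: uniq_leq_size => [|y]; first exact: effgens_uniq.
move=> /mem_effgens; rewrite frob_child // => -[lt_xy y_gen].
rewrite inE mem_filter /= lt_xy /=; case: eqP => //= y_xm; apply/mem_effgens.
have y_x b : 0 < b -> x + b = y -> b \in s.
  move=> b0 xby; have [lt_bm|le_mb] := ltnP b m.
    by have := lt_m b; rewrite b0 lt_bm inE => /(_ isT)/orP[/eqP|//]; lia.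
  case: (y_gen m (y - m)); try lia.
  by rewrite inE => /orP[/eqP | /leq_frob]; lia.
split=> [|a b a0 b0 aby]; first by lia.
case: (y_gen a b a0 b0 aby); rewrite inE => /orP[/eqP ab_x|]; try by [left|right].
  by right; apply: y_x; rewrite -?ab_x.
by left; apply: y_x; rewrite -?ab_x // addnC.
Qed.

(** Induction on the depth: removing a generator with [j] larger ones leaves [j] or [j.+1], and
    ['C(j, d)] and ['C(j + d, d)] are summed over [j] by the hockey-stick identity. *)
Lemma size_descendants_nonordinary d m s : nonordinary m s ->
  'C(size (effgens s), d) <= size (descendants d s)
    <= 'C((size (effgens s) + d).-1, d).
Proof.
elim: d s => [|d IHd] s s_m; first by rewrite !bin0.
have child x : x \in effgens s ->
    'C(count (ltn x) (effgens s), d) <= size (descendants d (x :: s))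
      <= 'C(count (ltn x) (effgens s) + d, d).
  move=> x_gen; have /andP[lo hi] := IHd _ (nonordinary_child s_m x_gen).
  have /andP[c_lo c_hi] := size_effgens_child s_m x_gen.
  rewrite (leq_trans _ lo) ?leq_bin2l //= (leq_trans hi) // leq_bin2l //; lia.
rewrite size_descendantsS addnS -sum_bin_col -(sum_bin_col_shift _ (leqnn d)).
rewrite -(sum_sorted_count (fun j => 'C(j, d)) (effgens_sorted s)).
rewrite -(sum_sorted_count (fun j => 'C(j + d, d)) (effgens_sorted s)).
by apply/andP; split; rewrite 2!big_seq; apply: leq_sum => x /child /andP[].
Qed.

(** * Ordinary semigroups and their descendants *)

Definition ordinary (n : nat) : seq nat := rev (iota 1 n).

Lemma mem_ordinary n a : (a \in ordinary n) = (0 < a <= n).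
Proof. by rewrite mem_rev mem_iota add1n ltnS. Qed.

Lemma ordinaryS n : ordinary n.+1 = n.+1 :: ordinary n.
Proof. by rewrite /ordinary -[X in iota _ X]addn1 iotaD rev_cat add1n. Qed.

Lemma frob_ordinary n : frob (ordinary n) = n.
Proof.
elim: n => [|n IHn]; first exact: big_nil.
by rewrite ordinaryS frob_cons IHn; apply/maxn_idPl.
Qed.

Lemma effgens_ordinary n : effgens (ordinary n) = iota n.+1 n.+1.
Proof.
apply: (irr_sorted_eq ltn_trans ltnn (effgens_sorted _) (iota_ltn_sorted _ _)).
move=> x; rewrite mem_iota; apply/idP/idP.
  move=> /mem_effgens; rewrite frob_ordinary => -[lt_nx gen_x].
  rewrite lt_nx ltnNge; apply/negP => le_x.
  by case: (gen_x n.+1 (x - n.+1)); rewrite ?mem_ordinary; lia.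
move=> /andP[lt_nx lt_x]; apply/mem_effgens; rewrite frob_ordinary; split=> //.
by move=> a b a0 b0 abx; rewrite !mem_ordinary; lia.
Qed.

Lemma nonordinary_ordinary_child n i :
  nonordinary n.+1 (n.+2 + i :: ordinary n).
Proof.
split=> [||a]; rewrite ?frob_cons ?frob_ordinary ?inE ?mem_ordinary; lia.
Qed.

(** Here [2n + 4] is twice the multiplicity [n + 2], but [2n + 5] stays indecomposable: it could
    only be [(n + 2) + (n + 3)], and [n + 3] is a gap. *)
Lemma size_effgens_ordinary_child0 n :
  size (effgens (n.+3 :: ordinary n.+1)) = n.+1.
Proof.
suff /perm_size-> : perm_eq (effgens (n.+3 :: ordinary n.+1))
    (rcons (iota n.+4 n) (n.+2 + n.+3)) by rewrite size_rcons size_iota.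
apply: uniq_perm => [||y]; first exact: effgens_uniq.
  by rewrite rcons_uniq iota_uniq mem_iota; lia.
rewrite mem_rcons inE mem_iota; apply/idP/idP.
  move=> /mem_effgens; rewrite frob_cons frob_ordinary => -[lt_ny gen_y].
  have : ~ (n.+2 + n.+2 <= y /\ y <> n.+2 + n.+3).
    move=> [le_y ne_y]; case: (gen_y n.+2 (y - n.+2)); rewrite ?inE ?mem_ordinary; lia.
  lia.
move=> y_in; apply/mem_effgens; rewrite frob_cons frob_ordinary; split; first by lia.
by move=> a b a0 b0 aby; rewrite !inE !mem_ordinary; lia.
Qed.

Lemma size_effgens_ordinary_childS n i : i < n ->
  size (effgens (n.+4 + i :: ordinary n.+1)) = n - i.+1.
Proof.
move=> lt_in.
suff -> : effgens (n.+4 + i :: ordinary n.+1) = iota (n.+4 + i.+1) (n - i.+1).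
  by rewrite size_iota.
apply: (irr_sorted_eq ltn_trans ltnn (effgens_sorted _) (iota_ltn_sorted _ _)).
move=> y; rewrite mem_iota; apply/idP/idP.
  move=> /mem_effgens; rewrite frob_cons frob_ordinary => -[lt_ny gen_y].
  have : ~ (n.+2 + n.+2 <= y /\ y <> n.+2 + (n.+4 + i)).
    move=> [le_y ne_y]; case: (gen_y n.+2 (y - n.+2)); rewrite ?inE ?mem_ordinary; lia.
  (* Unlike in the previous case, this number has another decomposition, [(n + 3) + (n + 3 + i)]. *)
  have : y <> n.+2 + (n.+4 + i).
    by case: (gen_y n.+3 (y - n.+3)); rewrite ?inE ?mem_ordinary; lia.
  lia.
move=> y_in; apply/mem_effgens; rewrite frob_cons frob_ordinary; split; first by lia.
by move=> a b a0 b0 aby; rewrite !inE !mem_ordinary; lia.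
Qed.

Lemma size_descendants_ordinaryS d n :
  size (descendants d.+1 (ordinary n.+1)) =
    size (descendants d (ordinary n.+2)) +
      (size (descendants d (n.+3 :: ordinary n.+1)) +
       \sum_(i < n) size (descendants d (n.+4 + i :: ordinary n.+1))).
Proof.
rewrite size_descendantsS effgens_ordinary /= !big_cons -ordinaryS.
rewrite -(big_mkord xpredT (fun i => size (descendants d (n.+4 + i :: _)))).
by rewrite /index_iota subn0 -[X in iota X n]addn0 iotaDl big_map.
Qed.

Lemma sum_rev_ord n (h : nat -> nat) : \sum_(i < n) h (n - i.+1) = \sum_(i < n) h i.
Proof. by rewrite [RHS](reindex_inj rev_ord_inj). Qed.

(** The 1 counts the ordinary descendant. Term [e] comes from the ordinary semigroup of genus
    [n + d - e], whose non-ordinary children have [e] generations left: first the child with most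
    effective generators, then the others together. *)
Lemma size_descendants_ordinary_lower d n :
  1 + \sum_(e < d) ('C(n + d - e, e) + 'C(n + d - e.+1, e.+1))
    <= size (descendants d (ordinary n.+1)).
Proof.
elim: d n => [|d IHd] n; first by rewrite big_ord0.
rewrite big_ord_recr addnA size_descendants_ordinaryS leq_add //=.
  by rewrite addnS -addSn.
rewrite addnK addnS -addSn addnK -sum_bin_col -(sum_rev_ord n (fun j => 'C(j, d))).
rewrite leq_add ?leq_sum // => [|i _].
  have /andP[lo _] := size_descendants_nonordinary d (nonordinary_ordinary_child n.+1 0).
  by move: lo; rewrite addn0 size_effgens_ordinary_child0.
have /andP[lo _] := size_descendants_nonordinary d (nonordinary_ordinary_child n.+1 i.+1).
by move: lo; rewrite addnS size_effgens_ordinary_childS.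
Qed.

(** Same splitting as for the lower bound. The inner sum stays unevaluated because the truncated
    predecessor makes [e = 0] exceptional. *)
Lemma size_descendants_ordinary_upper d n :
  size (descendants d (ordinary n.+1)) <=
    1 + \sum_(e < d) ('C((n + d).-1, e) + \sum_(j < n + d - e.+1) 'C((j + e).-1, e)).
Proof.
elim: d n => [|d IHd] n; first by rewrite big_ord0.
rewrite big_ord_recr addnA size_descendants_ordinaryS leq_add //=.
  by rewrite addnS -addSn.
rewrite addnK addnS -addSn -(sum_rev_ord n (fun j => 'C((j + d).-1, d))).
rewrite leq_add ?leq_sum // => [|i _].
  have /andP[_ hi] := size_descendants_nonordinary d (nonordinary_ordinary_child n.+1 0).
  by move: hi; rewrite addn0 size_effgens_ordinary_child0.
have /andP[_ hi] := size_descendants_nonordinary d (nonordinary_ordinary_child n.+1 i.+1).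
by move: hi; rewrite addnS size_effgens_ordinary_childS.
Qed.

Lemma size_descendants_root d :
  size (descendants d.+1 [::]) = size (descendants d (ordinary 1)).
Proof. by rewrite size_descendantsS (effgens_ordinary 0) big_seq1. Qed.

(** * Bounds on the levels of the tree *)

Lemma fib_le_size_descendants g : 2 <= g ->
  2 * fib g <= size (descendants g [::]).
Proof.
case: g => [|[|h]] // _; rewrite size_descendants_root.
apply: leq_trans (size_descendants_ordinary_lower _ 0).
(* Both halves of the bound are the antidiagonal sum for [fib h.+2]: one lacks its first term,
   supplied by the isolated 1, the other its last term, which is 0. *)
have := fib_sum_bin h.+1; rewrite sum_bin_antidiag_recl => fib_diag.
have fib_diag' : fib h.+2 = \sum_(i < h.+1) 'C(h.+1 - i, i).
  by rewrite fib_sum_bin big_ord_recr /= subnn addn0.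
by rewrite mul2n -addnn {1}fib_diag' fib_diag big_split /= !add0n addnCA.
Qed.

Lemma size_descendants_le g : 3 <= g ->
  size (descendants g [::]) <= 1 + 3 * 2 ^ (g - 3).
Proof.
case: g => [|[|[|h]]] // _; rewrite size_descendants_root.
apply: leq_trans (size_descendants_ordinary_upper _ 0) _.
rewrite add0n !subSS subn0 leq_add2l big_split /= sum_bin_row // expnS.
rewrite -[3]/(2 + 1) mulnDl mul1n leq_add2l.
(* It remains to bound the second half by [2 ^ h]: its term [e = 0] is [h + 1], the first two
   entries of row [h], and the later terms are the entries ['C(h, e.+2)]. *)
rewrite big_ord_recl /=.
under eq_bigr do rewrite bin0.
rewrite sum1_card card_ord.
have <- : 1 + h + \sum_(i < h.+1) 'C(h, i.+2) = 2 ^ h.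
  rewrite -(@sum_bin_row h h.+3) ?ltnS ?leqW // [RHS]big_ord_recl.
  by rewrite [X in _ = _ + X]big_ord_recl bin0 bin1 addnA.
apply: leq_add => //; apply: leq_sum => e _.
have le_eh : e <= h by rewrite -ltnS.
rewrite (eq_bigr (fun j : 'I_ _ => 'C(j + e, e.+1))) => [|j _]; last by rewrite addnS.
by rewrite sum_bin_col_shift // !subSS subnK.
Qed.

Lemma descendantsSP d s t :
  reflect (exists2 x, x \in effgens s & t \in descendants d (x :: s))
          (t \in descendants d.+1 s).
Proof.
by apply: (iffP allpairsPdep) => [[x [u [xs us ->]]]|[x xs ts]]; exists x => //; exists t.
Qed.

(** [descendants] unfolds at the root; this extends a branch at its leaf. *)
Lemma descendants_child d s t x :
  t \in descendants d s -> x \in effgens t -> x :: t \in descendants d.+1 s.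
Proof.
elim: d s => [|d IHd] s t_in x_gen; apply/descendantsSP.
  by move: t_in x_gen; rewrite inE => /eqP-> x_gen; exists x; rewrite ?inE.
by move/descendantsSP: t_in => [y y_gen t_in]; exists y => //; apply: IHd.
Qed.

Lemma drop_descendants d s t : t \in descendants d s -> drop d t = s.
Proof.
elim: d s => [|d IHd] s; first by rewrite inE drop0 => /eqP.
by move=> /descendantsSP[x _ /IHd tE]; rewrite -add1n -drop_drop tE /= drop0.
Qed.

(** Branches through distinct children are disjoint, since [drop d] recovers the child. *)
Lemma descendants_uniq d s : uniq (descendants d s).
Proof.
elim: d s => [|d IHd] s //=.
apply: allpairs_uniq_dep => [|x _|]; rewrite ?effgens_uniq //.
have tagE p : p \in [seq existT (fun=> seq nat) x t | x <- effgens s, t <- descendants d (x :: s)] ->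
    drop d (tagged p) = tag p :: s.
  by move=> /allpairsPdep[x [t [_ /drop_descendants tE ->]]].
move=> p q /tagE pE /tagE qE pq.
have [tpq] : tag p :: s = tag q :: s by rewrite -pE -qE pq.
by case: p q pq tpq {pE qE} => [x t] [y u] /= -> ->.
Qed.

Definition cogaps (s : seq nat) : set nat := [set n | n \notin s]%classic.

Lemma gaps_cogaps s : gaps (cogaps s) = [set` s]%classic.
Proof.
by apply/predeqP => n; split=> /= [/negP|ns]; rewrite ?negbK //; apply/negP; rewrite negbK.
Qed.

Lemma card_fset_set_seq (T : choiceType) (s : seq T) :
  uniq s -> #|` fset_set [set` s]%classic| = size s.
Proof.
move=> s_uniq; rewrite -[in RHS](undup_id s_uniq) -card_fseq; congr (#|` _|).
by apply/fsetP => x; rewrite in_fset_set // !inE; apply/idP/idP; rewrite inE.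
Qed.

(* [s] lists, in decreasing order, the gaps of a numerical semigroup. *)
Definition gap_list (s : seq nat) : Prop :=
  sorted gtn s /\ numerical_semigroup (cogaps s).

Lemma gap_list_child s x : gap_list s -> x \in effgens s -> gap_list (x :: s).
Proof.
move=> [s_sorted [s0 sD _]] /mem_effgens[lt_sx x_gen]; split.
  by case: s s_sorted lt_sx {s0 sD x_gen} => //= y s ->; rewrite frob_cons; lia.
split=> [|a b|].
- by rewrite /cogaps /= inE negb_or s0 andbT; lia.
- rewrite /cogaps /= !inE !negb_or => /andP[a_x a_s] /andP[b_x b_s].
  rewrite (sD a b) // andbT; apply/eqP => abx.
  case: (posnP a) => [a0|a0]; first by move: b_x; rewrite -abx a0 eqxx.
  case: (posnP b) => [b0|b0]; first by move: a_x; rewrite -abx b0 addn0 eqxx.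
  by case: (x_gen a b a0 b0 abx); apply/negP.
- by rewrite gaps_cogaps.
Qed.

Lemma descendants_gap_list d s t : gap_list s -> t \in descendants d s ->
  gap_list t /\ size t = d + size s.
Proof.
elim: d s => [|d IHd] s s_gaps; first by rewrite inE => /eqP->.
move=> /descendantsSP[x x_gen t_in].
have [t_gaps ->] := IHd _ (gap_list_child s_gaps x_gen) t_in.
by rewrite addnS.
Qed.

Lemma gtn_trans : transitive gtn.
Proof. by move=> b a c /= lt_ba lt_cb; apply: ltn_trans lt_ba. Qed.

Lemma gap_list_uniq s : gap_list s -> uniq s.
Proof.
by move=> [s_sorted _]; apply: sorted_uniq s_sorted; [exact: gtn_trans | exact: ltnn].
Qed.

Lemma gap_list_nil : gap_list [::].
Proof. by split=> //; split=> //; rewrite gaps_cogaps. Qed.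

Lemma genus_cogaps s : gap_list s -> genus (cogaps s) = size s.
Proof. by move=> /gap_list_uniq s_uniq; rewrite /genus gaps_cogaps card_fset_set_seq. Qed.

Lemma cogaps_inj s t : gap_list s -> gap_list t -> cogaps s = cogaps t -> s = t.
Proof.
move=> [s_sorted _] [t_sorted _] st.
apply: (irr_sorted_eq gtn_trans ltnn s_sorted t_sorted) => x.
apply: negb_inj; apply/idP/idP => x_in.
  by have : cogaps t x by rewrite -st.
by have : cogaps s x by rewrite st.
Qed.

Lemma frob_mem s : s != [::] -> frob s \in s.
Proof.
elim: s => // x s IHs _; rewrite frob_cons inE.
have [->|/IHs s_in] := eqVneq s [::]; first by rewrite /frob big_nil maxn0 eqxx.
by rewrite /maxn; case: ifP; rewrite ?s_in ?orbT ?eqxx.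
Qed.

Lemma gap_leq_frob L x : finite_set (gaps L) -> ~ L x -> x <= frob (fset_set (gaps L)).
Proof. by move=> fin_gaps Lx; apply: leq_frob; rewrite in_fset_set // inE. Qed.

(** All numbers above [F] lie in [L], hence so does [F] plus anything positive. Without gaps, [F] is
    0 and nothing is added. *)
Lemma numerical_semigroup_parent L :
  numerical_semigroup L -> numerical_semigroup (frob (fset_set (gaps L)) |` L)%classic.
Proof.
move=> [L0 LD fin_gaps]; set F := frob _.
have LF a : F < a -> L a.
  by move=> lt_Fa; apply: contrapT => /(gap_leq_frob fin_gaps); rewrite leqNgt lt_Fa.
split=> [|a b|]; first by right.
- move=> La Lb; case: (posnP a) => [->|a0] //; case: (posnP b) => [->|b0].
    by rewrite addn0.
  right; case: La => [->|La]; first by apply: LF; lia.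
  by case: Lb => [->|Lb]; [apply: LF; lia | apply: LD].
- by apply: sub_finite_set fin_gaps => x /= Lx Lx'; apply: Lx; right.
Qed.

Lemma descendants_complete g L : numerical_semigroup L -> genus L = g ->
  exists2 t, t \in descendants g [::] & L = cogaps t.
Proof.
elim: g L => [|g IHg] L Lsg gE; have [L0 LD fin_gaps] := Lsg.
  exists [::]; rewrite ?inE //; apply/predeqP => x; split=> // _.
  apply: contrapT => Lx; have : x \in fset_set (gaps L) by rewrite in_fset_set // inE.
  by rewrite (cardfs0_eq gE).
have := numerical_semigroup_parent Lsg; set F := frob _ => L'sg.
have F_in : F \in fset_set (gaps L).
  by apply: frob_mem; rewrite -size_eq0 -/(genus L) gE.
have LF : ~ L F by move: F_in; rewrite in_fset_set // inE.
have L'g : genus (F |` L)%classic = g.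
  have gapsE : gaps (F |` L)%classic = (gaps L `\ F)%classic.
    apply/predeqP => x; split=> [L'x|[Lx xF] [/xF|]//].
    by split=> [Lx|xF]; apply: L'x; [right | left].
  by apply/eqP; rewrite /genus gapsE fset_setD1 // -eqSS -gE /genus [in eqbRHS](cardfsD1 F) F_in.
have [t t_in tE] := IHg _ L'sg L'g.
have t_gap x : x \in t -> ~ L x /\ x < F.
  move=> x_t; have : ~ (F |` L)%classic x by rewrite tE /cogaps /= x_t.
  move=> L'x; have Lx : ~ L x by move=> Lx; apply: L'x; right.
  split=> //; rewrite ltn_neqAle (gap_leq_frob fin_gaps Lx) andbT.
  by apply/eqP => xF; apply: L'x; left.
have nt_L x : x < F -> x \notin t -> L x.
  move=> lt_xF x_t; have : (F |` L)%classic x by rewrite tE.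
  by case=> // xF; move: lt_xF; rewrite xF ltnn.
have F0 : 0 < F by rewrite lt0n; apply/eqP => F0; apply: LF; rewrite F0.
exists (F :: t).
  apply: descendants_child => //; apply/mem_effgens; split.
    by apply/frob_ltP; split=> // x /t_gap[].
  (* Two positive summands of [F] lying in the parent are smaller than [F], so they lie in [L] and
     would force [F] into [L]. *)
  move=> a b a0 b0 abF; apply/orP; apply: contra_notT LF.
  rewrite negb_or -abF => /andP[a_t b_t].
  by apply: LD; [apply: nt_L a_t | apply: nt_L b_t]; rewrite -abF; lia.
apply/predeqP => x; rewrite /cogaps /= inE negb_or; split=> [Lx|/andP[/eqP xF x_t]].
  apply/andP; split; first by apply/eqP => xF; apply: LF; rewrite -xF.
  by apply/negP => /t_gap[].
by have [] : (F |` L)%classic x by rewrite tE.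
Qed.

(** [cogaps] maps the level bijectively onto the family, which is therefore finite, so [fset_set]
    does not take its default value. *)
Lemma num_semigroupsE g : num_semigroups g = size (descendants g [::]).
Proof.
have gaps_of t : t \in descendants g [::] -> gap_list t /\ size t = g.
  by move=> /(descendants_gap_list gap_list_nil); rewrite addn0.
rewrite -(size_map cogaps) -card_fset_set_seq; last first.
  rewrite map_inj_in_uniq ?descendants_uniq // => s t /gaps_of[s_gaps _] /gaps_of[t_gaps _].
  exact: cogaps_inj.
rewrite /num_semigroups; congr (#|` fset_set _|).
apply/predeqP => L; split=> [[Lsg Lg]|/mapP[t /gaps_of[t_gaps <-] ->]].
  by have [t t_in ->] := descendants_complete Lsg Lg; apply: map_f.
by split; [case: t_gaps | apply: genus_cogaps].
Qed.

Theorem theorem5 :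
  (forall g : nat, 2 <= g -> 2 * fib g <= num_semigroups g) /\
  (forall g : nat, 3 <= g -> 2 * fib g <= num_semigroups g <= 1 + 3 * 2 ^ (g - 3)).
Proof.
split=> g le_g; rewrite num_semigroupsE ?fib_le_size_descendants //.
  by rewrite size_descendants_le.
exact: ltnW.
Qed.
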